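(* Let $\mathcal{A}_1=(Q,R_1,V_1,V_1',f_1)$ and $\mathcal{A}_2=(Q,R_2,V_2,V_2',f_2)$ be two stochastic CA with the same set of states $Q$ and explicit global functions $F_1,F_2$. Then $S_{F_1}=S_{F_2}$ if and only if for every configuration $c\in Q^{\mathbb{Z}}$ there exists a measure $\gamma_c\in\mathcal{M}(R_1^{\mathbb{Z}}\times R_2^{\mathbb{Z}})$ coupling $\mathcal{A}_1$ and $\mathcal{A}_2$ on $c$, i.e. such that (1) $\gamma_c$ is a coupling of $\nu_{R_1}$ and $\nu_{R_2}$, and (2) $\gamma_c\big(\{(s_1,s_2): F_1(c,s_1)=F_2(c,s_2)\}\big)=1$.
   Context: A stochastic CA is a tuple $(Q,R,V,V',f)$ with $Q$ a finite set of states, $R$ a finite set of random symbols, $V=\{v_1,\dots,v_r\}$, $V'=\{v'_1,\dots,v'_{r'}\}$ finite subsets of $\mathbb{Z}$, and $f:Q^r\times R^{r'}\to Q$. Its explicit global function $F:Q^{\mathbb{Z}}\times R^{\mathbb{Z}}\to Q^{\mathbb{Z}}$ is $F(c,s)_z=f\big((c_{z+v_1},\dots,c_{z+v_r}),(s_{z+v'_1},\dots,s_{z+v'_{r'}})\big)$. Cylinders are $[u]_z=\{c: c_{z+x}=u_x,\ 0\le x<|u|\}$; $\nu_R$ is the uniform Bernoulli measure on $R^{\mathbb{Z}}$; $\mathcal{M}(X)$ is the set of Borel probability measures on $X$. The stochastic global function is $S_F:Q^{\mathbb{Z}}\to\mathcal{M}(Q^{\mathbb{Z}})$, $S_F(c)([u]_z)=\nu_R(\{s: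 F(c,s)\in[u]_z\})$. A coupling of $\mu_1\in\mathcal{M}(A_1^{\mathbb{Z}})$ and $\mu_2\in\mathcal{M}(A_2^{\mathbb{Z}})$ is $\gamma\in\mathcal{M}(A_1^{\mathbb{Z}}\times A_2^{\mathbb{Z}})$ with $\gamma(E_1\times A_2^{\mathbb{Z}})=\mu_1(E_1)$ and $\gamma(A_1^{\mathbb{Z}}\times E_2)=\mu_2(E_2)$ for all measurable $E_1,E_2$. *)

(* Defs.v *)
From HB Require Import structures.
From mathcomp Require Import all_boot all_order all_algebra.
From mathcomp Require Import all_classical all_reals.
From mathcomp Require Import measure probability.

Set Implicit Arguments.
Unset Strict Implicit.
Unset Printing Implicit Defensive.

Import Order.TTheory GRing.Theory Num.Theory.
Local Open Scope classical_set_scope.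
Local Open Scope ring_scope.

#[short(type="finPointedType")]
HB.structure Definition FinPointed := {T of Finite T & isPointed T}.

(* A stochastic CA (Q, R, V, V', f) with V = (v_1,..,v_r), V' = (v'_1,..,v'_r')
   finite subsets of Z (listed without repetition) and f : Q^r x R^r' -> Q. *)
Record sCA (Q Rs : finType) := SCA {
  sca_r : nat;
  sca_r' : nat;
  sca_V : sca_r.-tuple int;
  sca_V' : sca_r'.-tuple int;
  sca_f : sca_r.-tuple Q -> sca_r'.-tuple Rs -> Q;
  sca_V_uniq : uniq sca_V;
  sca_V'_uniq : uniq sca_V' }.

Definition glob (Q Rs : finType) (A : sCA Q Rs)
    (c : int -> Q) (s : int -> Rs) : int -> Q :=
  fun z => @sca_f Q Rs A (map_tuple (fun v => c (z + v)) (sca_V A))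
                   (map_tuple (fun v => s (z + v)) (sca_V' A)).

Definition cyl (T : Type) (u : seq T) (z : int) : set (int -> T) :=
  [set c | [seq c (z + (x%:Z)) | x <- iota 0 (size u)] = u].

Definition cylinders (T : Type) : set (set (int -> T)) :=
  [set C | exists u z, C = cyl u z].

(* R^Z with the sigma-algebra generated by cylinders (= Borel sigma-algebra
   of the product topology, R finite discrete). *)
Definition rconf (Rs : finPointedType) := g_sigma_algebraType (@cylinders Rs).

Definition uniform_bernoulli (R : realType) (Rs : finPointedType)
    (nu : probability (rconf Rs) R) : Prop :=
  forall (u : seq Rs) (z : int),
    nu (cyl u z : set (rconf Rs)) = ((#|Rs|%:R)^-1 ^+ size u)%:E.

(* Stochastic global function S_F : Q^Z -> M(Q^Z), given by its values on
   cylinders: S_F(c)([u]_z) = nu_R({s | F(c,s) in [u]_z}). *)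
Definition SF (R : realType) (Q : finType) (Rs : finPointedType)
    (A : sCA Q Rs) (nu : probability (rconf Rs) R) :
    (int -> Q) -> seq Q -> int -> \bar R :=
  fun c u z => nu ((glob A c) @^-1` (cyl u z) : set (rconf Rs)).

Definition coupling (R : realType) d1 d2 (T1 : measurableType d1)
    (T2 : measurableType d2) (mu1 : probability T1 R) (mu2 : probability T2 R)
    (g : probability (T1 * T2)%type R) : Prop :=
  (forall E1 : set T1, measurable E1 -> g (E1 `*` setT) = mu1 E1) /\
  (forall E2 : set T2, measurable E2 -> g (setT `*` E2) = mu2 E2).

(* Main.v *)
Require Import Defs.
From HB Require Import structures.
From mathcomp Require Import all_boot all_order all_algebra.
From mathcomp Require Import all_classical all_reals.
From mathcomp Require Import measure probability.
From mathcomp Require Import ereal normedtype sequences lebesgue_integral.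
From mathcomp Require Import zify.

(* If gamma_c exists, both values S_F(c)([u]_z) are the gamma_c-measure of the
   event that the common image lies in [u]_z. Conversely, for each n couple the
   two Bernoulli measures by conditioning on the word produced on [-n, n]
   (which has the same law for both automata) and taking the product of the
   conditional measures: the images then agree on [-n, n]. A limit of these
   couplings along a free ultrafilter on n is a finitely additive function on
   the algebra of sets depending on finitely many coordinates; by compactness it
   is sigma-additive there, and its Caratheodory extension is gamma_c. *)

Set Implicit Arguments.
Unset Strict Implicit.
Unset Printing Implicit Defensive.

Import Order.TTheory GRing.Theory Num.Theory.
Import numFieldNormedType.Exports.

Local Open Scope classical_set_scope.
Local Open Scope ring_scope.

(** * Windows [-n, n] and local maps *)

Definition win {T : Type} (n : nat) (c : int -> T) : n.*2.+1.-tuple T :=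
  map_tuple (fun x : nat => c (- n%:Z + x%:Z)) (iota_tuple n.*2.+1 0).

Lemma tnth_win (T : Type) (n : nat) (c : int -> T) (i : 'I_n.*2.+1) :
  tnth (win n c) i = c (- n%:Z + i%:Z).
Proof. by rewrite tnth_map (tnth_nth 0%N) nth_iota // add0n. Qed.

Lemma winP (T : Type) (n : nat) (s t : int -> T) :
  win n s = win n t <-> (forall z : int, (`|z|%N <= n)%N -> s z = t z).
Proof.
split=> [st z zn|st]; last first.
  by apply: eq_from_tnth => i; rewrite !tnth_win st //; have := ltn_ord i; lia.
have zlt : (absz (z + n%:Z)%R < n.*2.+1)%N by lia.
have := congr1 (fun w => tnth w (Ordinal zlt)) st; rewrite !tnth_win /=.
by have -> : - n%:Z + (absz (z + n%:Z))%:Z = z by lia.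
Qed.

Lemma win_le (T : Type) (m n : nat) (s t : int -> T) :
  (m <= n)%N -> win n s = win n t -> win m s = win m t.
Proof. by move=> mn /winP st; apply/winP => z zm; apply: st; lia. Qed.

Lemma cyl_win (T : Type) (n : nat) (w : n.*2.+1.-tuple T) :
  cyl w (- n%:Z) = [set c | win n c = w].
Proof.
rewrite predeqE => c /=; rewrite /cyl /= size_tuple.
by split=> [cw|<-//]; apply: val_inj.
Qed.

Lemma cyl_local (T : Type) (u : seq T) (z : int) :
  exists n, forall s t, win n s = win n t -> cyl u z s -> cyl u z t.
Proof.
exists (`|z| + size u)%N => s t /winP st <-; rewrite /cyl /= size_map size_iota.
by apply/eq_in_map => x; rewrite mem_iota => xu; rewrite st //; lia.
Qed.

(** Uniform continuity for the product topology. Shift-equivariance is not part of it, since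
    [glob A c] with [c] fixed lacks it in general. *)
Definition local_map {S T : Type} (f : (int -> S) -> (int -> T)) :=
  forall n, exists N, forall s t, win N s = win N t -> win n (f s) = win n (f t).

Lemma glob_local (Q Rs : finType) (A : sCA Q Rs) (c : int -> Q) :
  local_map (glob A c).
Proof.
(* Sites of [-n, n] read random symbols at most max |v| further out, v ranging over [sca_V' A]. *)
move=> n; exists (n + \max_(v <- sca_V' A) `|v|)%N => s t /winP st.
apply/winP => z zn; rewrite /glob; congr (sca_f _ _).
apply: val_inj => /=; apply/eq_in_map => v vV; apply: st.
have : (`|v| <= \max_(v <- sca_V' A) `|v|)%N by exact: leq_bigmax_seq.
by lia.
Qed.

(** * Measurability of window events and the algebra of cylindrical sets *)

Lemma measurable_fibers d (T : measurableType d) (K : finType) (f : T -> K)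
    (C : set T) : (forall k, measurable (f @^-1` [set k])) ->
  (forall x y, f x = f y -> C x -> C y) -> measurable C.
Proof.
move=> mf fC.
have -> : C = \bigcup_(k in f @` C) (f @^-1` [set k]).
  rewrite predeqE => x; split=> [Cx|[_ [y Cy <-] yx]]; last exact: (fC y).
  by exists (f x) => //; exists x.
by apply: fin_bigcup_measurable => //; exact: finite_finset.
Qed.

Lemma measurable_win (Rs : finPointedType) (n : nat) (w : n.*2.+1.-tuple Rs) :
  measurable ([set s | win n s = w] : set (rconf Rs)).
Proof. by rewrite -cyl_win; apply: sub_sigma_algebra; exists w, (- n%:Z). Qed.

Lemma measurable_local (Rs : finPointedType) (n : nat) (C : set (rconf Rs)) :
  (forall s t, win n s = win n t -> C s -> C t) -> measurable C.
Proof. by apply: (@measurable_fibers _ (rconf Rs)) => w; exact: measurable_win. Qed.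

Lemma measurable_local_map (Rs : finPointedType) (T : Type)
    (f : (int -> Rs) -> (int -> T)) (n : nat) (C : set (int -> T)) :
    local_map f -> (forall s t, win n s = win n t -> C s -> C t) ->
  measurable (f @^-1` C : set (rconf Rs)).
Proof.
by move=> /(_ n)[N fN] CC; apply: (@measurable_local _ N) => s t /fN; exact: CC.
Qed.

Definition win2 {A B : Type} (n : nat) (p : (int -> A) * (int -> B)) :=
  (win n p.1, win n p.2).

(** For finite alphabets these are the clopen sets of the product. *)
Definition cylindrical {A B : Type} : set (set ((int -> A) * (int -> B))) :=
  [set C | exists n, forall p q, win2 n p = win2 n q -> C p -> C q].

Lemma measurable_cylindrical (A B : finPointedType) (C : set (rconf A * rconf B)) :
  cylindrical C -> measurable C.
Proof.
move=> [n]; apply: (@measurable_fibers _ (rconf A * rconf B)%type) => -[u v].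
have -> : win2 n @^-1` [set (u, v)] =
    ([set s | win n s = u] : set (rconf A)) `*` ([set s | win n s = v] : set (rconf B)).
  by rewrite predeqE => -[s t]; split=> [[<- <-]|/= [<- <-]].
by apply: measurableX; exact: measurable_win.
Qed.

(* A copy of the product type, carrying the algebra of cylindrical sets instead of
   the product sigma-algebra. *)
Definition pair_space (A B : finPointedType) : Type := ((int -> A) * (int -> B))%type.
HB.instance Definition _ (A B : finPointedType) := Pointed.on (pair_space A B).

Lemma cylindrical0 {A B : Type} : @cylindrical A B set0.
Proof. by exists 0%N. Qed.

Lemma cylindricalC {A B : Type} : setC_closed (@cylindrical A B).
Proof. by move=> C [n Cn]; exists n => p q /esym pq Cp /(Cn _ _ pq). Qed.

Lemma win2_le (A B : Type) (m n : nat) (p q : (int -> A) * (int -> B)) :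
  (m <= n)%N -> win2 n p = win2 n q -> win2 m p = win2 m q.
Proof.
move=> mn pq; rewrite /win2 (win_le mn (congr1 fst pq)).
by rewrite (win_le mn (congr1 snd pq)).
Qed.

Lemma cylindricalU {A B : Type} : setU_closed (@cylindrical A B).
Proof.
move=> C D [m Cm] [n Dn]; exists (maxn m n) => p q pq [Cp|Dp]; [left|right].
  by apply: Cm Cp; apply: win2_le pq; exact: leq_maxl.
by apply: Dn Dp; apply: win2_le pq; exact: leq_maxr.
Qed.

HB.instance Definition _ (A B : finPointedType) :=
  @isAlgebraOfSets.Build default_measure_display (pair_space A B)
    cylindrical cylindrical0 cylindricalU cylindricalC.

(** * Ultrafilter limits and compactness *)

Lemma free_ultrafilter :
  exists U : set_system nat, UltraFilter U /\ (forall n, U [set k | (n <= k)%N]).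
Proof.
have [U [UU sU]] := @ultraFilterLemma nat \oo _.
by exists U; split=> // n; apply: sU; exists n.
Qed.

Lemma ultra_fmap (S T : Type) (f : S -> T) (U : set_system S) :
  UltraFilter U -> UltraFilter (f @ U).
Proof.
move=> UU; split; first exact: fmap_proper_filter.
move=> G GF sG; apply/seteqP; split=> // A GA.
have [//|UnA] := in_ultra_setVsetC (f @^-1` A) UU.
have GnA : G (~` A) by exact: sG.
by have [x []] := filter_ex (filterI GA GnA).
Qed.

(** The image ultrafilter contains a compact segment, hence converges in it. *)
Lemma ultra_cvg_segment (R : realType) (S : Type) (U : set_system S)
    (u : S -> R) (a b : R) :
  UltraFilter U -> (forall k, a <= u k <= b) -> cvg (u @ U).
Proof.
move=> UU uab; have Uu : UltraFilter (u @ U) by exact: ultra_fmap.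
have := @segment_compact R a b; rewrite compact_ultra.
move=> /(_ _ Uu)[|l [_ ul]]; last by apply/cvg_ex; exists l.
by apply: (@filterE _ U) => k; rewrite /= in_itv; exact: uab.
Qed.

(** Otherwise the complements of all fibers belong to [U]; there are finitely many of them, so some
    [k] lies in all, which is absurd. *)
Lemma ultra_fin (S : Type) (K : finType) (U : set_system S) (f : S -> K) :
  UltraFilter U -> exists a, U [set k | f k = a].
Proof.
move=> UU; apply: contrapT => nU.
have /filter_ex[k] : \forall k \near U, forall a, f k <> a.
  apply: filter_forall => a.
  by have [fa|//] := in_ultra_setVsetC [set k | f k = a] UU; case: nU; exists a.
by move=> /(_ (f k)).
Qed.

(** Compactness of the configuration space: [p z] is the value of [x k z] for [U]-almost every [k],
    and a window has finitely many sites. *)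
Lemma ultralimit (S : Type) (A : finType) (U : set_system S) (x : S -> int -> A) :
  UltraFilter U -> exists p, forall n, U [set k | win n (x k) = win n p].
Proof.
move=> UU; pose p z := sval (cid (ultra_fin (fun k => x k z) UU)).
exists p => n.
have : \forall k \near U, forall i, tnth (win n (x k)) i = tnth (win n p) i.
  apply: filter_forall => i.
  have := svalP (cid (ultra_fin (fun k => x k (- n%:Z + i%:Z)) UU)).
  by apply: filterS => k /= xk; rewrite !tnth_win.
by apply: filterS => k xk; exact: eq_from_tnth.
Qed.

(** Otherwise choose [x N] in the union but outside the first [N] sets. The ultralimit of [x] stays
    in the union, which is closed, hence lies in some [F i]; as [F i] is open, [x j] is in [F i] for
    some j > i, a contradiction. *)
Lemma cylindrical_compact (A B : finType) (F : (set ((int -> A) * (int -> B)))^nat) :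
    (forall i, cylindrical (F i)) -> cylindrical (\bigcup_i F i) ->
  exists N, \bigcup_i F i `<=` \bigcup_(i < N) F i.
Proof.
move=> cF [n FC]; apply: contrapT => nF.
have /choice[x xF] : forall N, exists x,
    (\bigcup_i F i) x /\ ~ (\bigcup_(i < N) F i) x.
  move=> N; apply: contrapT => nx; apply: nF; exists N => y Fy.
  by apply: contrapT => nFy; apply: nx; exists y.
have [U [UU Uoo]] := free_ultrafilter.
have [p Up] := ultralimit (fun k => (x k).1) UU.
have [q Uq] := ultralimit (fun k => (x k).2) UU.
have Upq m : U [set k | win2 m (x k) = win2 m (p, q)].
  by apply: filterS (filterI (Up m) (Uq m)) => k [/= xp xq]; rewrite /win2 xp xq.
have [k xk] := filter_ex (Upq n).
have [i _ Fi] := FC _ _ xk (xF k).1.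
have [m Fm] := cF i.
have [j [/= xj ij]] := filter_ex (filterI (Upq m) (Uoo i.+1)).
by apply: (xF j).2; exists i => //; exact: Fm (esym xj) Fi.
Qed.

(** * Caratheodory extension from the cylindrical algebra *)

Definition pair_id (A B : finPointedType)
  (p : g_sigma_algebraType (@measurable _ (pair_space A B))) : rconf A * rconf B := p.

Lemma measurable_fun_rconf d (T : measurableType d) (A : finPointedType)
    (h : T -> rconf A) :
  (forall u z, measurable (h @^-1` cyl u z)) -> measurable_fun setT h.
Proof.
move=> mh; apply: (@measurability _ _ T (rconf A) setT h (@cylinders A)) => //.
by move=> _ [_ [u [z ->]] <-]; rewrite setTI; exact: mh.
Qed.

(** Lets a measure on the sigma-algebra generated by cylindrical sets be pushed forward to the
    product sigma-algebra. *)
Lemma measurable_pair_id (A B : finPointedType) : measurable_fun setT (@pair_id A B).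
Proof.
apply/measurable_fun_pairP; split; apply: measurable_fun_rconf => u z;
  apply: sub_sigma_algebra; have [n un] := cyl_local u z; exists n => p q.
  by move=> /(congr1 fst) /un.
by move=> /(congr1 snd) /un.
Qed.

HB.instance Definition _ (A B : finPointedType) :=
  isMeasurableFun.Build _ _ _ _ (@pair_id A B) (@measurable_pair_id A B).

(** By [cylindrical_compact], a disjoint sequence with cylindrical union is exhausted by finitely
    many terms, so finite additivity gives sigma-additivity on the algebra. *)
Lemma cylindrical_extension (R : realType) (A B : finPointedType)
    (m : set ((int -> A) * (int -> B)) -> R) :
    (forall C, 0 <= m C) ->
    (forall C D, cylindrical C -> cylindrical D -> C `&` D = set0 ->
      m (C `|` D) = m C + m D) ->
    m setT = 1 ->
  exists g : probability (rconf A * rconf B)%type R,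
    forall C, cylindrical C -> g C = (m C)%:E.
Proof.
move=> m_ge0 mU mT.
have m0 : m set0 = 0.
  have := mU set0 set0 cylindrical0 cylindrical0 (setI0 _).
  by rewrite setU0 => /eqP; rewrite -subr_eq subrr => /eqP.
pose mE (C : set (pair_space A B)) := (m C)%:E.
have mE0 : mE set0 = 0%E by rewrite /mE m0.
have mE_ge0 C : (0 <= mE C)%E by rewrite lee_fin.
have cylindrical_big F n : (forall i, cylindrical (F i)) ->
    cylindrical (\bigcup_(i < n) F i : set (pair_space A B)).
  move=> cF; apply: (@fin_bigcup_measurable _ (pair_space A B)) => //.
  by move=> i _; exact: cF.
have m_sum F n : (forall i, cylindrical (F i)) -> trivIset setT F ->
    m (\bigcup_(i < n) F i) = \sum_(0 <= i < n) m (F i).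
  move=> cF tF; elim: n => [|n IH].
    by rewrite big_geq // bigcup_mkord big_ord0.
  rewrite big_nat_recr //= -IH -mU //; last 2 first.
  - exact: cylindrical_big.
  - rewrite -subset0 => p [[i /= ilt Fip] Fnp].
    by move: ilt; rewrite (tF i n I I (ex_intro _ p (conj Fip Fnp))) ltnn.
  by rewrite !bigcup_mkord big_ord_recr.
have mE_sigma : semi_sigma_additive mE.
  move=> F cF tF cUF.
  have [N FN] := cylindrical_compact cF cUF.
  apply: cvg_near_cst; exists N => // n /= Nn.
  rewrite /mE sumEFin -m_sum //; congr (m _)%:E.
  apply/seteqP; split=> [p [i _ Fi]|p /FN [i /= iN Fi]]; first by exists i.
  by exists i => //=; exact: leq_trans iN Nn.
pose mu0 : {measure set (pair_space A B) -> \bar R} :=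
  HB.pack mE (isMeasure.Build _ _ _ mE mE0 mE_ge0 mE_sigma).
pose sigmaT := g_sigma_algebraType (@measurable _ (pair_space A B)).
pose mu1 : {measure set sigmaT -> \bar R} := measure_extension mu0.
have mu1E C : cylindrical C -> mu1 C = (m C)%:E.
  by move=> cC; exact: (@measurable_mu_extE _ _ _ mu0).
have mu1T : mu1 setT = 1%E by rewrite mu1E ?mT //; exists 0%N.
pose P1 : probability sigmaT R :=
  HB.pack (Measure.sort mu1) (Measure_isProbability.Build _ _ _ mu1 mu1T).
by exists (distribution P1 (@pair_id A B)).
Qed.

(** * Probability measures: partitions, null sets, uniqueness *)

Lemma fine_probability_fibers d (T : measurableType d) (R : realType)
    (P : probability T R) (K : finType) (f : T -> K) (E : set T) :
    (forall k, measurable (f @^-1` [set k])) -> measurable E ->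
  fine (P E) = \sum_k fine (P (E `&` f @^-1` [set k])).
Proof.
move=> mf mE.
have mEf k : measurable (E `&` f @^-1` [set k]) by exact: measurableI.
have EE : E = \bigcup_(k in [set: K]) (E `&` f @^-1` [set k]).
  by rewrite predeqE => x; split=> [Ex|[k _ []//]]; exists (f x).
have tE : trivIset [set: K] (fun k => E `&` f @^-1` [set k]).
  by move=> i j _ _ [x [[_ <-] [_ <-]]].
rewrite [in LHS]EE measure_fin_bigcup //; last exact: finite_finset.
have -> : [set: K] = [set` index_enum K].
  by rewrite predeqE => k; split=> // _; rewrite /= mem_index_enum.
rewrite -fsbig_seq ?index_enum_uniq // sum_fine //= => k _.
exact: fin_num_measure.
Qed.

Lemma probability_bigcap d (T : measurableType d) (R : realType)
    (P : probability T R) (D : (set T)^nat) :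
    (forall n, measurable (D n)) -> (forall n, P (D n) = 1%E) ->
  P (\bigcap_n D n) = 1%E.
Proof.
move=> mD D1; have mI : measurable (\bigcap_n D n) by exact: bigcapT_measurable.
have mC : measurable (~` \bigcap_n D n) by exact: measurableC.
suff PC : P (~` \bigcap_n D n) = 0%E.
  by rewrite -[X in P X]setCK probability_setC // PC sube0.
apply: measure_negligible => //; rewrite setC_bigcap.
apply: negligible_bigcup => n; apply/negligibleP; first exact: measurableC.
by rewrite [LHS](probability_setC P (mD n)) D1 subee.
Qed.

(** Sets determined by a window form a pi-system generating the sigma-algebra, so the uniqueness
    theorem for measures applies. *)
Lemma rconf_probability_ext (R : realType) (A : finPointedType)
    (P P' : probability (rconf A) R) :
    (forall n (C : set (int -> A)),
      (forall s t, win n s = win n t -> C s -> C t) -> P C = P' C) ->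
  forall E, measurable E -> P E = P' E.
Proof.
move=> PP'.
pose G : set (set (rconf A)) :=
  [set C | exists n, forall s t, win n s = win n t -> C s -> C t].
apply: (measure_unique G (fun=> setT)).
- apply/seteqP; split.
    apply: smallest_sub; first exact: smallest_sigma_algebra.
    by move=> _ [u [z ->]]; apply: sub_gen_smallest; exact: cyl_local.
  apply: smallest_sub; first exact: sigma_algebra_measurable.
  by move=> C [n]; exact: measurable_local.
- move=> C D [m Cm] [n Dn]; exists (maxn m n) => s t st [Cs Ds]; split.
    by apply: Cm Cs; apply: win_le st; exact: leq_maxl.
  by apply: Dn Ds; apply: win_le st; exact: leq_maxr.
- by move=> _; exists 0%N.
- by rewrite bigcup_const.
- by move=> C [n]; exact: PP'.
- by move=> _; rewrite [X in (X < _)%E](probability_setT P) ltry.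
Qed.

(** Reduces the check of a marginal to window sets, by comparing the law of [h] with [P]. *)
Lemma rconf_distribution d (T : measurableType d) (R : realType)
    (A : finPointedType) (g : probability T R) (h : T -> rconf A)
    (P : probability (rconf A) R) : measurable_fun setT h ->
    (forall n (C : set (int -> A)),
      (forall s t, win n s = win n t -> C s -> C t) -> g (h @^-1` C) = P C) ->
  forall E, measurable E -> g (h @^-1` E) = P E.
Proof.
move=> mh; pose X : {mfun T >-> rconf A} :=
  HB.pack h (isMeasurableFun.Build _ _ _ _ h mh).
exact: (@rconf_probability_ext R A (distribution g X) P).
Qed.

Lemma probability_setI1 d (T : measurableType d) (R : realType)
    (P : probability T R) (E X : set T) :
  measurable E -> measurable X -> P E = 1%E -> P (X `&` E) = P X.
Proof.
move=> mE mX E1.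
have PEC : P (~` E) = 0%E by rewrite probability_setC // E1 subee.
suff XE : P (X `\` E) = 0%E.
  by rewrite [RHS](measureDI P mX mE) [Z in (Z + _)%E]XE add0e.
apply: measure_negligible; first exact: measurableD.
by exists (~` E); split=> //; exact: measurableC.
Qed.

(** Handles the words of probability zero, where no conditional measure is available. *)
Lemma fine_measureI_eq0 d (T : measurableType d) (R : realType)
    (P : probability T R) (E B : set T) :
  measurable E -> measurable B -> fine (P B) = 0 -> fine (P (E `&` B)) = 0.
Proof.
move=> mE mB B0; have mEB : measurable (E `&` B) by exact: measurableI.
apply/eqP; rewrite eq_le fine_ge0 ?measure_ge0 // andbT -B0.
by apply: fine_le; rewrite ?fin_num_measure // le_measure ?inE.
Qed.

(** * Agreement of the two images *)

Definition agree (A B T : Type) (f1 : (int -> A) -> (int -> T))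
    (f2 : (int -> B) -> (int -> T)) n : set ((int -> A) * (int -> B)) :=
  [set p | win n (f1 p.1) = win n (f2 p.2)].

Lemma cylindrical_agree (A B T : Type) (f1 : (int -> A) -> (int -> T))
    (f2 : (int -> B) -> (int -> T)) n :
  local_map f1 -> local_map f2 -> cylindrical (agree f1 f2 n).
Proof.
move=> /(_ n)[N1 f1N] /(_ n)[N2 f2N].
exists (maxn N1 N2) => p q pq; rewrite /agree /= => pE.
rewrite -(f1N p.1) -?(f2N p.2) //.
  exact: win_le (leq_maxr _ _) (congr1 snd pq).
exact: win_le (leq_maxl _ _) (congr1 fst pq).
Qed.

(** Reduces equality of the images, which may involve infinitely many coordinates, to countably many
    events that are cylindrical for local maps. *)
Lemma agree_bigcap (A B T : Type) (f1 : (int -> A) -> (int -> T))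
    (f2 : (int -> B) -> (int -> T)) :
  [set p | f1 p.1 = f2 p.2] = \bigcap_n agree f1 f2 n.
Proof.
rewrite predeqE => p; split=> [/= fp n _|fp]; first by rewrite /agree /= fp.
by apply/funext => z; have /winP -> // := fp `|z|%N I.
Qed.

Lemma measurable_agree (A B : finPointedType) (T : Type)
    (f1 : (int -> A) -> (int -> T)) (f2 : (int -> B) -> (int -> T)) :
  local_map f1 -> local_map f2 ->
  measurable ([set p | f1 p.1 = f2 p.2] : set (rconf A * rconf B)).
Proof.
move=> loc1 loc2; rewrite agree_bigcap; apply: bigcapT_measurable => n.
by apply: measurable_cylindrical; exact: cylindrical_agree.
Qed.

(** * Coupling two measures over the common law of their images *)

Section relative_coupling.
Variables (R : realType) (Q : finType) (A B : finPointedType).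
Variables (f1 : (int -> A) -> (int -> Q)) (f2 : (int -> B) -> (int -> Q)).
Variables (P1 : probability (rconf A) R) (P2 : probability (rconf B) R).
Hypotheses (loc1 : local_map f1) (loc2 : local_map f2).
Hypothesis P12 : forall n w,
  P1 [set s | win n (f1 s) = w] = P2 [set s | win n (f2 s) = w].

Variable P : probability (rconf A * rconf B)%type R.
Hypothesis PX : forall (E : set (rconf A)) (F : set (rconf B)),
  measurable E -> measurable F -> P (E `*` F) = (P1 E * P2 F)%E.

Let B1 n (w : n.*2.+1.-tuple Q) : set (rconf A) := [set s | win n (f1 s) = w].
Let B2 n (w : n.*2.+1.-tuple Q) : set (rconf B) := [set s | win n (f2 s) = w].

Let mB1 n (w : n.*2.+1.-tuple Q) : measurable (B1 w).
Proof.
by apply: (@measurable_local_map _ _ f1 n [set t | win n t = w]) => // s t /= ->.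
Qed.

Let mB2 n (w : n.*2.+1.-tuple Q) : measurable (B2 w).
Proof.
by apply: (@measurable_local_map _ _ f2 n [set t | win n t = w]) => // s t /= ->.
Qed.

(* The mixture over [w] of the products of [P1] and [P2] conditioned on the event
   that the image has the word [w] on the window [-n, n]; since P1 (B1 w) =
   P2 (B2 w), one of the two normalizing factors cancels against the weight of
   [w]. Words of probability zero contribute 0 because 0^-1 = 0. *)
Let rho n (C : set (rconf A * rconf B)) : R :=
  \sum_(w : n.*2.+1.-tuple Q) (fine (P1 (B1 w)))^-1 *
    fine (P (C `&` (B1 w `*` B2 w))).

Let rho_ge0 n C : 0 <= rho n C.
Proof.
by apply: sumr_ge0 => w _; rewrite mulr_ge0 ?invr_ge0 ?fine_ge0 // measure_ge0.
Qed.

Let rhoU n C D : measurable C -> measurable D -> C `&` D = set0 ->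
  rho n (C `|` D) = rho n C + rho n D.
Proof.
move=> mC mD CD; rewrite -big_split; apply: eq_bigr => w _ /=.
have mBX : measurable (B1 w `*` B2 w) by exact: measurableX.
rewrite -mulrDr setIUl (measureU P) //; try exact: measurableI; last first.
  by rewrite setIACA CD set0I.
by rewrite fineD // ?fin_num_measure //; exact: measurableI.
Qed.

(** The summand is P1 (E ∩ B1 w) P2 (B2 w) / P1 (B1 w); by [P12] the last two factors cancel, and
    the sum over [w] is the total probability formula for [P1]. *)
Let rho_fst n E : measurable E -> rho n (E `*` setT) = fine (P1 E).
Proof.
move=> mE.
rewrite (@fine_probability_fibers _ _ _ P1 _ (fun s => win n (f1 s)) E) //;
  last exact: mB1.
apply: eq_bigr => w _; rewrite -[_ @^-1` _]/(B1 w).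
have mEB : measurable (E `&` B1 w) by exact: measurableI.
rewrite -setXI setTI PX // fineM ?fin_num_measure //.
rewrite -[P2 (B2 w)]P12 -/(B1 w) mulrC -mulrA.
(* Without cancellation, when the weight vanishes, both sides are 0. *)
have [P0|P0] := eqVneq (fine (P1 (B1 w))) 0; last by rewrite mulfV // mulr1.
by rewrite P0 mul0r mulr0; apply/esym/fine_measureI_eq0.
Qed.

Let rho_snd n E : measurable E -> rho n (setT `*` E) = fine (P2 E).
Proof.
move=> mE.
rewrite (@fine_probability_fibers _ _ _ P2 _ (fun s => win n (f2 s)) E) //;
  last exact: mB2.
apply: eq_bigr => w _; rewrite -[_ @^-1` _]/(B2 w).
have mEB : measurable (E `&` B2 w) by exact: measurableI.
rewrite -setXI setTI PX // fineM ?fin_num_measure //.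
rewrite [P1 (B1 w)]P12 -/(B2 w) mulrA.
have [P0|P0] := eqVneq (fine (P2 (B2 w))) 0; last by rewrite mulVf // mul1r.
by rewrite P0 mulr0 mul0r; apply/esym/fine_measureI_eq0.
Qed.

Let rho_setT n : rho n setT = 1.
Proof. by rewrite -setXTT rho_fst // probability_setT. Qed.

(** On [B1 w] times [B2 w] both images read [w] on [-n, n], hence agree on the smaller window:
    intersecting with [agree f1 f2 m] changes no summand. *)
Let rho_agree m n : (m <= n)%N -> rho n (agree f1 f2 m) = 1.
Proof.
move=> mn; rewrite -(rho_setT n); apply: eq_bigr => w _; rewrite setTI.
suff -> : agree f1 f2 m `&` (B1 w `*` B2 w) = B1 w `*` B2 w by [].
apply/setIidr => p [/= p1 p2]; rewrite /agree /=.
by apply: (win_le mn); rewrite p1 p2.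
Qed.

Let rho_le1 n C : measurable C -> rho n C <= 1.
Proof.
move=> mC; rewrite -(rho_setT n) -(setvU C) rhoU ?setICl //;
  last exact: measurableC.
by rewrite lerDr.
Qed.

Lemma relative_coupling : exists g : probability (rconf A * rconf B)%type R,
  coupling P1 P2 g /\ g [set p | f1 p.1 = f2 p.2] = 1%E.
Proof.
have [U [UU Uoo]] := free_ultrafilter.
(* [cylindrical_extension] expects a nonnegative function on all sets: the limit of [rho n] on
   measurable ones, 0 elsewhere. *)
have /choice[m mP] : forall C : set (rconf A * rconf B), exists l : R, 0 <= l /\
    (measurable C -> rho n C @[n --> U] --> l).
  move=> C; have [mC|nC] := pselect (measurable C); last by exists 0.
  have /cvg_ex[l rl] : cvg (rho n C @[n --> U]).
    by apply: (@ultra_cvg_segment _ _ _ _ 0 1) => // n; rewrite rho_ge0 rho_le1.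
  by exists l; split=> //; apply: cvgr_to_ge rl _; exact: nearW.
(* A value that [rho n] takes for [U]-almost every [n] survives in the limit; the marginals, the
   total mass and the agreement on a window are all obtained so. *)
have mE (C : set (rconf A * rconf B)) l : measurable C ->
    (\forall n \near U, rho n C = l) -> m C = l.
  by move=> /(mP C).2 mC /cvg_near_cst; exact: cvg_unique.
have [||g gE] := @cylindrical_extension R A B m (fun C => (mP C).1).
- move=> C D /measurable_cylindrical mC /measurable_cylindrical mD CD.
  suff rhoCD : rho n (C `|` D) @[n --> U] --> m C + m D.
    exact: cvg_unique ((mP _).2 (measurableU _ _ mC mD)) rhoCD.
  have -> : (fun n => rho n (C `|` D)) = (fun n => rho n C + rho n D).
    by apply/funext => n; exact: rhoU.
  by apply: cvgD; [exact: (mP C).2|exact: (mP D).2].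
- by apply: mE => //; apply: nearW => n; exact: rho_setT.
have gEU (C : set (rconf A * rconf B)) l : cylindrical C ->
    (\forall n \near U, rho n C = l) -> g C = l%:E.
  by move=> cC Cl; rewrite gE // (mE C l) //; exact: measurable_cylindrical.
exists g; split; first split.
(* Every [rho k] has first marginal [P1], so [g] has it on window sets, hence on all measurable
   sets. *)
- move=> E mE0; transitivity (g (fst @^-1` E)).
    by congr (g _); rewrite predeqE => p; split=> [[]//|Ep]; split.
  apply: (rconf_distribution measurable_fst) mE0 => n C Cn.
  have mC := measurable_local Cn.
  rewrite -[P1 C]fineK ?fin_num_measure //.
  apply: gEU; first by exists n => p q /(congr1 fst); exact: Cn.
  apply: nearW => k; rewrite -(rho_fst k mC).
  by congr (rho k _); rewrite predeqE => p; split=> [Cp|[]//]; split.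
- move=> E mE0; transitivity (g (snd @^-1` E)).
    by congr (g _); rewrite predeqE => p; split=> [[]//|Ep]; split.
  apply: (rconf_distribution measurable_snd) mE0 => n C Cn.
  have mC := measurable_local Cn.
  rewrite -[P2 C]fineK ?fin_num_measure //.
  apply: gEU; first by exists n => p q /(congr1 snd); exact: Cn.
  apply: nearW => k; rewrite -(rho_snd k mC).
  by congr (rho k _); rewrite predeqE => p; split=> [Cp|[]//]; split.
rewrite agree_bigcap; apply: probability_bigcap => n.
  apply: measurable_cylindrical; exact: cylindrical_agree.
apply: gEU; first exact: cylindrical_agree.
(* [U] is free, so [U]-almost every [k] is at least [n], and then [rho k] gives mass 1 to agreement
   on [-n, n]. *)
by apply: filterS (Uoo n) => k; exact: rho_agree.
Qed.

End relative_coupling.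

Theorem theorem2 (R : realType) (Q : finType) (Rs1 Rs2 : finPointedType)
    (A1 : sCA Q Rs1) (A2 : sCA Q Rs2)
    (nu1 : probability (rconf Rs1) R) (nu2 : probability (rconf Rs2) R) :
  uniform_bernoulli nu1 -> uniform_bernoulli nu2 ->
  (SF A1 nu1 = SF A2 nu2 <->
   forall c : int -> Q,
     exists g : probability (rconf Rs1 * rconf Rs2)%type R,
       coupling nu1 nu2 g /\
       g [set p | glob A1 c p.1 = glob A2 c p.2] = 1%E).
Proof.
move=> _ _; split=> [SFE c|gc].
  have nuX (E : set (rconf Rs1)) (F : set (rconf Rs2)) :
      measurable E -> measurable F ->
      (nu1 \x nu2)%E (E `*` F) = (nu1 E * nu2 F)%E.
    exact: product_measure1E.
  (* What remains is the equality of the laws of the words on [-n, n]: it is the equality of the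
     [SF] values on the cylinder of [w] placed at -n. *)
  apply: (relative_coupling (glob_local A1 c) (glob_local A2 c) _ nuX) => n w.
  by have := congr1 (fun S => S c (val w) (- n%:Z)) SFE; rewrite /SF cyl_win.
apply/funext => c; apply/funext => u; apply/funext => z.
have [g [[g1 g2] gE]] := gc c.
have [n un] := cyl_local u z.
have mB1 := measurable_local_map (glob_local A1 c) un.
have mB2 := measurable_local_map (glob_local A2 c) un.
have mE := measurable_agree (glob_local A1 c) (glob_local A2 c).
rewrite /SF -g1 // -g2 //.
(* Both sides are now [g]-measures; the two events coincide after intersection with the almost sure
   event that the images are equal. *)
rewrite -(probability_setI1 mE _ gE); last exact: measurableX.
rewrite -[RHS](probability_setI1 mE _ gE); last exact: measurableX.
congr (g _); apply/seteqP; split=> p [[/= c1 c2] e]; split=> //; split=> //=.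
  by rewrite -e.
by rewrite e.
Qed.
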